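(* Let $X$ be a non-empty set and $R$ a binary relation on $X$. Then $\overline{R}$ has as realizer the set of interval order extensions of $R$ if and only if $R$ is acyclic.
   Context: For a binary relation $R$ on a set $X$, the asymmetric part is $P(R)=\{(x,y)\in X\times X : (x,y)\in R \text{ and } (y,x)\notin R\}$. The transitive closure $\overline{R}$ is defined by: $(x,y)\in\overline{R}$ iff there exist $m\geq 1$ and $z_0,\dots,z_m\in X$ with $x=z_0$, $z_m=y$ and $(z_k,z_{k+1})\in R$ for all $0\le k\le m-1$. An $R$-cycle is a non-empty subset $Y\subseteq X$ such that $(x,y)\in\overline{R}$ and $(y,x)\in\overline{R}$ for all $x,y\in Y$; $R$ is acyclic if there is no $R$-cycle. A relation $R^*$ on $X$ is an extension of $R$ if $R\subseteq R^*$ and $P(R)\subseteq P(R^* )$. An interval order is an irreflexive and transitive relation $R$ satisfying the Russell-Wiener axiom: for all $x,y,z,w\in X$, $(x,y)\in R$, $(z,y)\notin R$ and $(z,w)\in R$ imply $(x,w)\in R$. A set $\mathcal{Q}$ of relations on $X$ is a realizer of a relation $S$ if $\mathcal{Q}$ is non-empty and $S=\bigcap_{Q\in\mathcal{Q}}Q$. *)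

(* Defs.v *)
From mathcomp Require Export all_boot.
From mathcomp Require Export boolp classical_sets.

Set Implicit Arguments.
Unset Strict Implicit.
Unset Printing Implicit Defensive.

Local Open Scope classical_set_scope.

Definition asym_part (X : Type) (R : set (X * X)) : set (X * X) :=
  [set p | R (p.1, p.2) /\ ~ R (p.2, p.1)].

(* Only the values z 0, ..., z m of the sequence z matter. *)
Definition trans_closure (X : Type) (R : set (X * X)) : set (X * X) :=
  [set p | exists (m : nat) (z : nat -> X),
     [/\ 0 < m, p.1 = z 0, z m = p.2 &
         forall k, k < m -> R (z k, z k.+1)]].

(* x = y is allowed below: a singleton Y is a cycle when its point is
   trans_closure R-related to itself. *)
Definition is_cycle (X : Type) (R : set (X * X)) (Y : set X) : Prop :=
  Y !=set0 /\
  forall x y, Y x -> Y y -> trans_closure R (x, y) /\ trans_closure R (y, x).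

Definition acyclic (X : Type) (R : set (X * X)) : Prop :=
  ~ exists Y : set X, is_cycle R Y.

Definition is_extension (X : Type) (R Rstar : set (X * X)) : Prop :=
  R `<=` Rstar /\ asym_part R `<=` asym_part Rstar.

Definition irreflexive_rel (X : Type) (R : set (X * X)) : Prop :=
  forall x, ~ R (x, x).

Definition transitive_rel (X : Type) (R : set (X * X)) : Prop :=
  forall x y z, R (x, y) -> R (y, z) -> R (x, z).

Definition russell_wiener (X : Type) (R : set (X * X)) : Prop :=
  forall x y z w, R (x, y) -> ~ R (z, y) -> R (z, w) -> R (x, w).

Definition interval_order (X : Type) (R : set (X * X)) : Prop :=
  [/\ irreflexive_rel R, transitive_rel R & russell_wiener R].

Definition is_realizer (X : Type) (Qs : set (set (X * X))) (S : set (X * X)) :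
    Prop :=
  Qs !=set0 /\ S = \bigcap_(Q in Qs) Q.

Definition interval_order_extensions (X : Type) (R : set (X * X)) :
    set (set (X * X)) :=
  [set Q | interval_order Q /\ is_extension R Q].

(* Main.v *)
Require Import Defs.

Set Implicit Arguments.
Unset Strict Implicit.
Unset Printing Implicit Defensive.

Local Open Scope classical_set_scope.

(** If [R] is acyclic, its transitive closure is a strict partial order, and a
    strict partial order is the intersection of the strict linear orders that
    contain it (Szpilrajn, Dushnik-Miller): when [(x, y)] is missing and
    [x <> y], the reversed pair [(y, x)] may be added without creating a cycle
    ([add_pair_strict]), and the result is contained in a linear order
    ([szpilrajn]), which cannot contain [(x, y)] by asymmetry.  Linear orders
    are interval orders, and every interval order containing [R] extends [R],
    because asymmetry puts all of its pairs in its asymmetric part.  So every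
    pair outside the closure is missed by an interval order extension, whereas
    pairs of the closure lie in all of them by transitivity.

    Conversely, a point of a cycle is related to itself by the closure, hence
    by any member of a realizer, but interval orders are irreflexive. *)

Lemma sub_trans_closure (X : Type) (R : set (X * X)) : R `<=` trans_closure R.
Proof.
move=> [x y] Rxy; exists 1, (fun k => if k is 0 then x else y).
by split=> // -[].
Qed.

Lemma trans_closure_trans (X : Type) (R : set (X * X)) :
  transitive_rel (trans_closure R).
Proof.
move=> x y z [m [u [m0 /= xu uy Ru]]] [n [v [n0 /= yv vz Rv]]].
(* At the junction [k = m] the two chains agree, as [u m = y = v 0]. *)
exists (m + n), (fun k => if k <= m then u k else v (k - m)); split=> //=.
- by rewrite addn_gt0 m0.
- by rewrite leqNgt -[X in X < _]addn0 ltn_add2l n0 /= addKn.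
move=> k kmn; case: (ltngtP k m) => [km|mk|->].
- exact: Ru.
- by rewrite subSn ?(ltnW mk)//; apply: Rv; rewrite ltn_subLR// ltnW.
- by rewrite subSnn uy yv; apply: Rv.
Qed.

Lemma trans_closure_min (X : Type) (R Q : set (X * X)) :
  transitive_rel Q -> R `<=` Q -> trans_closure R `<=` Q.
Proof.
move=> Qtr RQ [x y] [[|m] [z [// _ /= -> <- Rz]]].
elim: m Rz => [|m IHm] Rz; first exact/RQ/Rz.
apply: Qtr (RQ _ (Rz m.+1 (ltnSn _))).
by apply: IHm => k km; apply: Rz; apply: ltnW.
Qed.

(** Singletons account for all cycles: each point of a cycle is one. *)
Lemma acyclicP (X : Type) (R : set (X * X)) :
  acyclic R <-> irreflexive_rel (trans_closure R).
Proof.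
split=> [acR x Rxx | irrR [Y [[x Yx] cycY]]].
  by apply: acR; exists [set x]; split=> [|_ _ -> ->]; [exists x|].
by apply: (irrR x); have [] := cycY x x Yx Yx.
Qed.

Definition strict_order (X : Type) (S : set (X * X)) : Prop :=
  irreflexive_rel S /\ transitive_rel S.

Definition linear (X : Type) (S : set (X * X)) : Prop :=
  forall x y, x <> y -> S (x, y) \/ S (y, x).

(** For transitive [S], this is the transitive closure of [S] and [(a, b)]. *)
Definition add_pair (X : Type) (S : set (X * X)) (a b : X) : set (X * X) :=
  S `|` [set p | (p.1 = a \/ S (p.1, a)) /\ (p.2 = b \/ S (b, p.2))].

Lemma strict_asym (X : Type) (S : set (X * X)) x y :
  strict_order S -> S (x, y) -> ~ S (y, x).
Proof. by move=> [irrS trS] Sxy Syx; apply: (irrS x); apply: trS Syx. Qed.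

(** A new loop, or a composite of two new pairs, needs a path from [b] back to
    [a] in [S]; [a <> b] excludes the empty path and [~ S (b, a)] any other. *)
Lemma add_pair_strict (X : Type) (S : set (X * X)) a b :
  strict_order S -> a <> b -> ~ S (b, a) -> strict_order (add_pair S a b).
Proof.
move=> [irrS trS] neq_ab nSba.
have no_return w : w = a \/ S (w, a) -> w = b \/ S (b, w) -> False.
  move=> [->|Swa] [wb|Sbw] //.
    by rewrite wb in Swa.
  exact/nSba/(trS _ w).
split=> [x [/irrS//|[/= xa bx]]|x y z]; first exact: (no_return x).
move=> [Sxy|[/= xa bY]] [Syz|[/= ya bz]].
- by left; apply: trS Syz.
- right; split=> //=; right; case: ya => [<-//|]; exact: trS.
- right; split=> //=; right; case: bY => [<-//|Sby]; exact: trS Syz.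
- by case: (no_return y).
Qed.

Lemma szpilrajn (X : Type) (S : set (X * X)) :
  strict_order S -> exists L, [/\ strict_order L, linear L & S `<=` L].
Proof.
move=> strS.
(* Zorn is applied to the relations to be joined to [S], rather than to those
   containing [S], so that the empty chain has an upper bound. *)
have [F FP Ftot|A [strA maxA]] :=
    @Zorn_bigcup _ [set A | strict_order (S `|` A)].
  set U := \bigcup_(A in F) A.
  have common p q : (S `|` U) p -> (S `|` U) q -> exists B,
      [/\ strict_order (S `|` B), B `<=` U, (S `|` B) p & (S `|` B) q].
    have FU A : F A -> A `<=` U by move=> FA r Ar; exists A.
    move=> [Sp|[A FA Ap]] [Sq|[B FB Bq]].
    - by exists set0; rewrite setU0; split.
    - by exists B; split; [exact: FP|exact: FU|left|right].
    - by exists A; split; [exact: FP|exact: FU|right|left].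
    - have [AB|BA] := Ftot _ _ FA FB.
      + by exists B; split; [exact: FP|exact: FU|right; exact: AB|right].
      + by exists A; split; [exact: FP|exact: FU|right|right; exact: BA].
  split=> [x Ux|x y z Uxy Uyz].
    by have [B [[irrB _] _ Bx _]] := common _ _ Ux Ux; exact: irrB Bx.
  have [B [[_ trB] BU Bxy Byz]] := common _ _ Uxy Uyz.
  by case: (trB _ _ _ Bxy Byz) => [Sxz|/BU Uxz]; [left|right].
exists (S `|` A); split=> // a b neq_ab.
apply: contrapT => /not_orP[nLab nLba].
set B := add_pair (S `|` A) a b.
have SAB : S `|` A `<=` B by move=> p; left.
apply: (maxA B); last first.
  rewrite /= (_ : S `|` B = B); first exact: add_pair_strict.
  by apply/setUidPr => p Sp; apply: SAB; left.
split=> [|BA]; first by move=> p Ap; apply: SAB; right.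
by apply: nLab; right; apply: BA; right; split; left.
Qed.

Lemma linear_interval_order (X : Type) (L : set (X * X)) :
  strict_order L -> linear L -> interval_order L.
Proof.
move=> [irrL trL] linL; split=> // x y z w Lxy nLzy Lzw.
have [zy|/linL[//|Lyz]] := pselect (z = y).
  by rewrite zy in Lzw; apply: trL Lzw.
exact: (trL _ _ _ (trL _ _ _ Lxy Lyz) Lzw).
Qed.

Lemma strict_extension (X : Type) (R Q : set (X * X)) :
  strict_order Q -> R `<=` Q -> is_extension R Q.
Proof.
move=> strQ RQ; split=> // -[x y] [/= /RQ Qxy _].
by split=> //=; apply: strict_asym Qxy.
Qed.

(** When [x = y] any linear extension will do; otherwise one is taken above the
    closure with [(y, x)] adjoined. The former case provides the non-emptiness
    that a realizer must have. *)
Lemma separating_extension (X : Type) (R : set (X * X)) x y :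
  irreflexive_rel (trans_closure R) -> ~ trans_closure R (x, y) ->
  exists2 Q, interval_order_extensions R Q & ~ Q (x, y).
Proof.
move=> irrR nRxy.
have strR : strict_order (trans_closure R).
  by split=> //; apply: trans_closure_trans.
have extend S : strict_order S -> trans_closure R `<=` S ->
    exists L, [/\ strict_order L, interval_order_extensions R L & S `<=` L].
  move=> /szpilrajn[L [strL linL SL]] RS; exists L; split=> //.
  split; first exact: linear_interval_order.
  by apply: strict_extension => // p /sub_trans_closure/RS/SL.
have [xy|neq_xy] := pselect (x = y).
  have [L [[irrL _] extL _]] := extend _ strR (fun _ => id).
  by exists L => //; rewrite xy.
have /extend[|L [strL extL SL]] : strict_order (add_pair (trans_closure R) y x).
- by apply: add_pair_strict => // /esym.
- by move=> p; left.
exists L => //; apply: strict_asym strL _; apply: SL.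
by right; split; left.
Qed.

Theorem theorem4p1 (X : Type) (X_nonempty : [set: X] !=set0) (R : set (X * X)) :
  is_realizer (interval_order_extensions R) (trans_closure R) <-> acyclic R.
Proof.
split=> [[[Q extQ] realR] | /acyclicP irrR].
  apply/acyclicP => x; rewrite realR => /(_ Q extQ).
  by case: extQ => -[irrQ _ _] _; apply: irrQ.
split.
  have [x _] := X_nonempty.
  by have [Q extQ _] := separating_extension irrR (irrR x); exists Q.
apply/seteqP; split=> [p Rp Q [[_ trQ _] [RQ _]] | [x y] allQ].
  exact: trans_closure_min Rp.
apply: contrapT => /(separating_extension irrR)[Q extQ].
by apply; apply: allQ.
Qed.
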